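(* Let $k\ge 4$ and let $S$ be an $n$-term graphical sequence. Suppose $S$ has a realization $G$ (a simple graph) containing a cycle $C$ of length $k$, and suppose there exist a vertex $x$ of $G$ not on $C$ with $d_G(x)\ge \lfloor k/2\rfloor+1$ and a vertex $w$ on $C$ with $d_G(w)\ge 3$. Then $S$ has a realization containing a cycle of length $k+1$ as a subgraph.
   Context: A sequence $S=(d_1,\dots,d_n)$ of non-negative integers is graphical if there is a simple graph on $n$ vertices $v_1,\dots,v_n$ with $d(v_i)=d_i$ for all $i$; such a graph is a realization of $S$. $\lfloor x\rfloor$ denotes the largest integer at most $x$. ''Containing a cycle'' means containing it as a (not necessarily induced) subgraph. *)

(* Defs.v *)
From mathcomp Require Import all_boot.

Set Implicit Arguments.
Unset Strict Implicit.
Unset Printing Implicit Defensive.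

Definition simple_graph (T : finType) (e : rel T) : Prop :=
  symmetric e /\ irreflexive e.

Definition deg (T : finType) (e : rel T) (x : T) : nat :=
  #|[set y | e x y]|.

(* The vertex [v_i] is the index [i : 'I_n]; the sequence need not be sorted. *)
Definition realization (n : nat) (S : n.-tuple nat) (e : rel 'I_n) : Prop :=
  simple_graph e /\ forall i : 'I_n, deg e i = tnth S i.

Definition graphical (n : nat) (S : n.-tuple nat) : Prop :=
  exists e : rel 'I_n, realization S e.

(* A cycle subgraph (possibly with chords), listed in cyclic order from some
   starting vertex. [ucycle] alone also accepts lists of fewer than 3 vertices,
   hence the bound on [k]. *)
Definition cycle_of_length (T : finType) (e : rel T) (k : nat) (c : seq T) :
  Prop := [/\ 3 <= k, size c = k & ucycle e c].

(* Main.v *)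
Require Import Defs.
From mathcomp Require Import all_boot zify.

(** Suppose that every degree-preserving switch of two edges fails to produce a
    cycle of length k + 1. If x has a neighbour v on C, it has no two
    neighbours on C at cyclic distance at most 2 (otherwise x, or x together
    with a neighbour off C, can be spliced into C), so a count gives x two
    neighbours y, z off C, both adjacent to v; switching the edge xz against
    the edge of C that follows the successor of v then creates a cycle through
    v, y, x that skips only that successor. If x has no neighbour on C, a third
    edge wu at w can be switched against an edge xy to make x adjacent to w,
    unless u is adjacent to the neighbours of x, in which case the same
    splicing applies along a path from C through u to x. *)

Set Implicit Arguments.
Unset Strict Implicit.
Unset Printing Implicit Defensive.

(** * Degree-preserving switches of two edges *)

Section Switch.

Variable T : finType.
Implicit Types (e : rel T) (a b c d u v x y z : T).

Definition edge a b u v : bool :=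
  (u == a) && (v == b) || (u == b) && (v == a).

(** The 2-switch trading the edges [ab], [cd] for [ac], [bd]; the order of the arguments selects
    this re-pairing. *)
Definition switch e a b c d u v : bool :=
  e u v && ~~ edge a b u v && ~~ edge c d u v || edge a c u v || edge b d u v.

Lemma edge_sym a b : symmetric (edge a b).
Proof. by move=> u v; rewrite /edge orbC andbC [X in _ || X]andbC. Qed.

Lemma edgeC a b u v : edge a b u v = edge b a u v.
Proof. by rewrite /edge orbC. Qed.

Lemma switchC e a b c d u v : switch e a b c d u v = switch e b a d c u v.
Proof. by rewrite /switch !(edgeC a b) !(edgeC c d) orbAC. Qed.

Lemma switch_flip e a b c d u v : switch e a b c d u v = switch e c d a b u v.
Proof.
by rewrite /switch !(edgeC a c) !(edgeC b d) [_ && ~~ edge c d u v]andbAC.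
Qed.

Lemma eq_deg e e' v : (forall u, e v u = e' v u) -> deg e v = deg e' v.
Proof. by move=> ee'; apply: eq_card => u; rewrite !inE. Qed.

Lemma switch_sub e a b c d u v :
  e u v -> ~~ edge a b u v -> ~~ edge c d u v -> switch e a b c d u v.
Proof. by rewrite /switch => -> -> ->. Qed.

(** The neighbourhood of [a] trades [b] for [c]. The symmetries of [switch] reduce the other three
    endpoints to this case. *)
Lemma switch_deg1 e a b c d :
  uniq [:: a; b; c; d] -> e a b -> ~~ e a c ->
  deg (switch e a b c d) a = deg e a.
Proof.
rewrite /= !inE !negb_or => /and4P[/and3P[nab nac nad] _ _ _] eab neac.
rewrite /deg.
have -> : [set y | switch e a b c d a y] = c |: ([set y | e a y] :\ b).
  apply/setP => y; rewrite !inE /switch /edge eqxx /=.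
  by rewrite (negPf nab) (negPf nac) (negPf nad) /= !orbF !andbT orbC andbC.
rewrite cardsU1 !inE (negPf neac) andbF /= (cardsD1 b [set y | e a y]).
by rewrite inE eab.
Qed.

Lemma switch_deg e a b c d :
  simple_graph e -> uniq [:: a; b; c; d] -> e a b -> e c d ->
  ~~ e a c -> ~~ e b d -> deg (switch e a b c d) =1 deg e.
Proof.
move=> [esym _] U eab ecd neac nebd v.
have [U1 U2 U3] : [/\ uniq [:: b; a; d; c], uniq [:: c; d; a; b]
                    & uniq [:: d; c; b; a]].
  by split; rewrite (perm_uniq (s2 := [:: a; b; c; d])) //;
    apply/permP => p /=; lia.
have [->|va] := eqVneq v a; first exact: switch_deg1.
have [->|vb] := eqVneq v b.
  by rewrite (eq_deg (switchC e a b c d b)) switch_deg1 // esym.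
have [->|vc] := eqVneq v c.
  by rewrite (eq_deg (switch_flip e a b c d c)) switch_deg1 // esym.
have [->|vd] := eqVneq v d.
  rewrite (eq_deg (switch_flip e a b c d d)) (eq_deg (switchC e c d a b d)).
  by rewrite switch_deg1 // esym.
apply: eq_deg => u; rewrite /switch /edge.
by rewrite (negPf va) (negPf vb) (negPf vc) (negPf vd) /= !andbT !orbF.
Qed.

Lemma switch_simple e a b c d :
  simple_graph e -> a != c -> b != d -> simple_graph (switch e a b c d).
Proof.
move=> [esym eirr] nac nbd; split=> [u v|u].
  by rewrite /switch esym !(edge_sym _ _ u v).
rewrite /switch /edge eirr /=.
have neq p q : p != q -> (u == p) && (u == q) = false.
  by have [->|//] := eqVneq u p => /negPf.
by rewrite (neq _ _ nac) (neq _ _ nbd) neq ?neq // eq_sym.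
Qed.

End Switch.

(** * Lengthening a cycle by one vertex *)

Section Extension.

Variable T : finType.
Implicit Types (e : rel T) (a b u v x y z : T) (c p : seq T).

(** Only the degrees of [e] are retained, so that the property pulls back along switches; [m] stands
    for the length of the present cycle. *)
Definition extendable e m : Prop :=
  exists (e' : rel T) (c : seq T),
    [/\ simple_graph e', deg e' =1 deg e, ucycle e' c & size c = m.+1].

Lemma ucycle_extendable e c m :
  simple_graph e -> ucycle e c -> size c = m.+1 -> extendable e m.
Proof. by move=> Ge Uc sc; exists e, c. Qed.

Lemma switch_extendable e a b u v m :
  simple_graph e -> uniq [:: a; b; u; v] -> e a b -> e u v ->
  ~~ e a u -> ~~ e b v -> extendable (switch e a b u v) m -> extendable e m.
Proof.
move=> Ge U eab euv neau nebv [e' [c [Ge' de' Uc sc]]]; exists e', c.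
by split=> // w; rewrite de' switch_deg.
Qed.

(** Listing the cycle from [v] on exposes the two vertices after [v], around which all splicings
    below take place. *)
Lemma ucycle_rot e c v :
  ucycle e c -> 3 < size c -> v \in c ->
  let a := next c v in let b := next c a in
  exists p, [/\ ucycle e [:: v, a, b & p], (size p).+3 = size c,
                [:: v, a, b & p] =i c & p != [::]].
Proof.
move=> /andP[Cc Uc] sc vc a b.
have [i p Ep] := rot_to vc.
have sp : size c = size (v :: p) by rewrite -Ep size_rot.
have Uvp : uniq (v :: p) by rewrite -Ep rot_uniq.
have nE w : next c w = next (v :: p) w by rewrite -Ep next_rot.
case: p => [|a' [|b' p]] in Ep sp Uvp nE; rewrite ?sp // in sc.
have Ea : a = a' by rewrite /a nE /= eqxx.
have Eb : b = b'.
  move: Uvp => /= /and3P[]; rewrite !inE !negb_or => /and3P[va _ _] _ _.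
  by rewrite /b nE Ea /= (eq_sym a' v) (negPf va) eqxx.
exists p; rewrite Ea Eb -Ep; split.
- by rewrite /ucycle rot_cycle rot_uniq Cc.
- by rewrite sp.
- by move=> w; rewrite mem_rot.
- by case: p sc {Ep sp Uvp nE}.
Qed.

Section Cycle.

Variables (e : rel T) (c : seq T).
Hypotheses (Ge : simple_graph e) (Uc : ucycle e c) (c4 : 3 < size c).

Let esym : symmetric e := proj1 Ge.

Lemma extend_insert x v :
  x \notin c -> v \in c -> e x v -> e x (next c v) -> extendable e (size c).
Proof.
move=> xc vc exv exa; have [p [Up sp Ep _]] := ucycle_rot Uc c4 vc.
set a := next c v in exa Up Ep; set b := next c a in Up Ep.
rewrite -Ep in xc; apply: (@ucycle_extendable _ [:: v, x, a, b & p]) => //.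
  case/andP: Up => /= /and3P[eva eab pp] Up; rewrite /ucycle /=.
  rewrite esym exv exa eab pp /=.
  by move: xc Up; rewrite /= !inE !negb_or (eq_sym x v) =>
    /and4P[-> -> -> ->] /and4P[/and3P[-> -> ->] -> -> ->].
by rewrite /= sp.
Qed.

(** [x] and [y] take the place of the single vertex [next c v], a net gain of one. *)
Lemma extend_replace x y v :
  x \notin c -> y \notin c -> x != y -> v \in c ->
  e v x -> e x y -> e y (next c (next c v)) -> extendable e (size c).
Proof.
move=> xc yc nxy vc evx exy eyb; have [p [Up sp Ep _]] := ucycle_rot Uc c4 vc.
set a := next c v in eyb Up Ep; set b := next c a in eyb Up Ep.
rewrite -Ep in xc; rewrite -Ep in yc.
apply: (@ucycle_extendable _ [:: v, x, y, b & p]) => //.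
  case/andP: Up => /= /and3P[eva eab pp] Up; rewrite /ucycle /=.
  rewrite evx exy eyb pp /=.
  move: xc yc Up; rewrite /= !inE !negb_or !(eq_sym v) nxy.
  by move=> /and4P[-> _ -> ->] /and4P[-> _ -> ->]
            /and4P[/and3P[_ -> ->] _ -> ->].
by rewrite /= sp.
Qed.

(* The edge xz is switched against the edge [next v, next (next v)] of C, so
   that y, x take the place of [next v] in the cycle. *)
Lemma extend_path x y z v :
  uniq [:: x; y; z] -> x \notin c -> y \notin c -> z \notin c -> v \in c ->
  e v y -> e y x -> e x z -> ~~ e z (next c v) -> extendable e (size c).
Proof.
move=> U xc yc zc vc evy eyx exz neza.
have [exb|nexb] := boolP (e x (next c (next c v))).
  apply: (extend_replace yc xc _ vc evy eyx exb).
  by move: U; rewrite /= !inE negb_or eq_sym => /andP[/andP[]].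
have [p [Up sp Ep _]] := ucycle_rot Uc c4 vc.
set a := next c v in neza nexb Up Ep; set b := next c a in nexb Up Ep.
rewrite -Ep in xc; rewrite -Ep in yc; rewrite -Ep in zc.
case/andP: Up => /= /and3P[eva eab pp] Up.
move: U Up; rewrite /= !inE !negb_or => /and3P[/andP[nxy nxz] nyz _].
move=> /and4P[/and3P[nva nvb vp] /andP[nab ap] bp Up].
move: xc yc zc; rewrite !inE !negb_or.
move=> /and4P[nxv nxa nxb xp] /and4P[nyv nya nyb yp] /and4P[nzv nza nzb zp].
have U4 : uniq [:: x; z; b; a].
  by rewrite /= !inE !negb_or nxz nxb nxa nzb nza (eq_sym b) nab.
have eba : e b a by rewrite esym.
apply: (switch_extendable Ge U4 exz eba nexb neza).
apply: (@ucycle_extendable _ [:: v, y, x, b & p]).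
- exact: switch_simple.
- apply/andP; split; last first.
    rewrite /= !inE !negb_or nvb vp bp Up !(eq_sym v) nyv nxv.
    by rewrite (eq_sym y) nxy nyb yp nxb xp.
  rewrite /=; apply/and4P; split.
  + apply: switch_sub => //; rewrite /edge.
      by rewrite !(eq_sym v) (negPf nxv) (negPf nzv).
    by rewrite (negPf nvb) (negPf nva).
  + apply: switch_sub => //; rewrite /edge.
      by rewrite (eq_sym y) (negPf nxy) (negPf nyz).
    by rewrite (negPf nyb) (negPf nya).
  + by rewrite /switch /edge !eqxx /= !orbT.
  (* Both removed edges meet [{a, x}], while the path from [b] back to [v] avoids these two
     vertices. *)
  + apply: (@sub_in_path _ [pred u | (u != a) && (u != x)]) pp.
      move=> u w; rewrite !inE => /andP[nua nux] /andP[nwa nwx] euw.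
      apply: switch_sub => //; rewrite /edge.
        by rewrite (negPf nux) (negPf nwx) !andbF.
      by rewrite (negPf nua) (negPf nwa) !andbF.
    rewrite /= all_rcons /= !(eq_sym b) nab nxb nva eq_sym nxv /=.
    apply/allP => u up /=; apply/andP; split.
      by apply: contraNneq ap => <-.
    by apply: contraNneq xp => <-.
- by rewrite /= sp.
Qed.

(** Either [z] sees the successor of [v] and is inserted after [v], or the missing edge permits the
    switch of [extend_path]. *)
Lemma extend_common_neighbor x y z v :
  uniq [:: x; y; z] -> x \notin c -> y \notin c -> z \notin c -> v \in c ->
  e v y -> e y x -> e x z -> e v z -> extendable e (size c).
Proof.
move=> U xc yc zc vc evy eyx exz evz.
have [eza|neza] := boolP (e z (next c v)).
  by apply: (extend_insert zc vc) => //; rewrite esym.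
exact: (extend_path U xc yc zc vc evy eyx exz neza).
Qed.

(** Trading [xy] and the cycle edge from [v] to its successor [a] for [xa] and [yv] keeps [xv], so
    [x] fits between [v] and [a]. Hence every neighbour of [x] off the cycle may later be assumed
    adjacent to every neighbour of [x] on it. *)
Lemma extend_nonadjacent x y v :
  x \notin c -> y \notin c -> v \in c -> e x v -> e x y -> ~~ e y v ->
  extendable e (size c).
Proof.
move=> xc yc vc exv exy neyv.
have [exa|nexa] := boolP (e x (next c v)); first exact: (extend_insert xc vc).
have nxy : x != y by apply: contraNneq neyv => <-.
have [p [Up sp Ep p0]] := ucycle_rot Uc c4 vc.
set a := next c v in nexa Up Ep; set b := next c a in Up Ep.
rewrite -Ep in xc; rewrite -Ep in yc.
case/andP: Up => /= /and3P[eva eab]; rewrite rcons_path => /andP[pp ebv] Up.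
move: Up; rewrite /= !inE !negb_or.
move=> /and4P[/and3P[nva nvb vp] /andP[nab ap] bp Up].
move: xc yc; rewrite !inE !negb_or.
move=> /and4P[nxv nxa nxb xp] /and4P[nyv nya nyb yp].
have U4 : uniq [:: x; y; a; v].
  by rewrite /= !inE !negb_or nxy nxa nxv nya nyv (eq_sym a) nva.
have eav : e a v by rewrite esym.
apply: (switch_extendable Ge U4 exy eav nexa neyv).
have lp : last b p \in p by case: (p) p0 => //= q s _; exact: mem_last.
have bpP : all [pred u | (u != a) && (u != x)] (b :: p).
  rewrite /= !(eq_sym b) nab nxb /=; apply/allP => u up /=; apply/andP; split.
    by apply: contraNneq ap => <-.
  by apply: contraNneq xp => <-.
(* Again both removed edges meet [{a, x}], so edges avoiding these vertices survive. *)
have sub : {in [pred u | (u != a) && (u != x)], forall u w, w != x -> w != a ->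
              e u w -> switch e x y a v u w}.
  move=> u; rewrite !inE => /andP[nua nux] w nwx nwa euw.
  apply: switch_sub => //; rewrite /edge.
    by rewrite (negPf nux) (negPf nwx) !andbF.
  by rewrite (negPf nua) (negPf nwa) !andbF.
apply: (@ucycle_extendable _ [:: v, x, a, b & p]).
- exact: switch_simple.
- apply/andP; split; last first.
    rewrite /= !inE !negb_or nva nvb vp nab ap bp Up !(eq_sym v) nxv.
    by rewrite nxa nxb xp.
  rewrite /= rcons_path; apply/and5P; split.
  + apply: switch_sub => //; rewrite /edge; first by rewrite esym.
      by rewrite !(eq_sym v) (negPf nxv) (negPf nyv).
    by rewrite (negPf nva) (negPf nxa) andbF.
  + by rewrite /switch /edge !eqxx /= !orbT.
  + apply: switch_sub => //; rewrite /edge.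
      by rewrite !(eq_sym a) (negPf nxa) (negPf nya).
    by rewrite !(eq_sym b) (negPf nvb) (negPf nab) !andbF.
  + apply: (@sub_in_path _ [pred u | (u != a) && (u != x)]) bpP pp.
    by move=> u w uP; rewrite !inE => /andP[nwa nwx]; apply: sub.
  + apply: sub => //; [|by rewrite eq_sym].
    exact: (allP bpP _ (mem_last b p)).
- by rewrite /= sp.
Qed.

(** * Counting neighbours on the cycle *)

Lemma next_inj : injective (next c).
Proof. by case/andP: Uc => _ U; apply: (can_inj (prev_next U)). Qed.

Lemma card_subset_cycle (A : {set T}) : {subset A <= c} -> #|A| <= size c.
Proof.
case/andP: Uc => _ U Ac; rewrite -(card_uniqP U).
by apply/subset_leq_card/subsetP.
Qed.

(** [A] and its shift along the cycle are disjoint and equal in size. *)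
Lemma card_disjoint_next (A : {set T}) :
  {subset A <= c} -> (forall v, v \in A -> next c v \notin A) ->
  2 * #|A| <= size c.
Proof.
move=> Ac An; have dis : [disjoint A & next c @: A].
  rewrite disjoint_sym disjoints_subset; apply/subsetP => _ /imsetP[v vA ->].
  by rewrite inE An.
have := @card_subset_cycle (A :|: next c @: A).
rewrite cardsU (disjoint_setI0 dis) cards0 subn0 card_imset; last exact: next_inj.
rewrite mul2n -addnn; apply=> u; rewrite inE => /orP[/Ac//|/imsetP[v vA ->]].
by rewrite mem_next Ac.
Qed.

(** [A] and its shifts by one and two steps are pairwise disjoint; injectivity of [next c] separates
    the two shifts. *)
Lemma card_disjoint_next2 (A : {set T}) :
  {subset A <= c} -> (forall v, v \in A -> next c v \notin A) ->
  (forall v, v \in A -> next c (next c v) \notin A) ->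
  3 * #|A| <= size c.
Proof.
move=> Ac An Ann; pose B := next c @: A.
have dis : [disjoint A & B].
  rewrite disjoint_sym disjoints_subset; apply/subsetP => _ /imsetP[v vA ->].
  by rewrite inE An.
have dis2 : [disjoint A :|: B & next c @: B].
  rewrite disjoint_sym disjoints_subset; apply/subsetP.
  move=> _ /imsetP[_ /imsetP[v vA ->] ->]; rewrite !inE negb_or Ann //=.
  by rewrite mem_imset ?An //; exact: next_inj.
have := @card_subset_cycle ((A :|: B) :|: next c @: B).
rewrite cardsU (disjoint_setI0 dis2) cards0 subn0.
rewrite cardsU (disjoint_setI0 dis) cards0 subn0 !card_imset; try exact: next_inj.
rewrite !mulSn mul0n addn0 addnA; apply=> u; rewrite !inE.
case/orP=> [/orP[/Ac//|/imsetP[v vA ->]]|/imsetP[_ /imsetP[v vA ->] ->]].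
  by rewrite mem_next Ac.
by rewrite !mem_next Ac.
Qed.

Lemma extend_adjacent x v :
  x \notin c -> (size c)./2 + 1 <= deg e x -> v \in c -> e x v ->
  extendable e (size c).
Proof.
move=> xc dx vc exv.
pose A := [set u | (u \in c) && e x u].
pose B := [set u | (u \notin c) && e x u].
have Ac : {subset A <= c} by move=> u; rewrite inE => /andP[].
have dAB : deg e x = #|A| + #|B|.
  rewrite /deg -(cardsID [set u in c]); congr (_ + _); apply: eq_card => u.
    by rewrite !inE andbC.
  by rewrite !inE.
case: (pickP [pred u in A | next c u \in A]) => [u /= /andP[]|An].
  by rewrite !inE mem_next => /andP[uc exu] /andP[_]; apply: extend_insert.
have {}An u : u \in A -> next c u \notin A.
  by move=> uA; move: (An u) => /=; rewrite uA /= => ->.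
have A2 := card_disjoint_next Ac An.
have /card_gt0P[y] : 0 < #|B| by lia.
rewrite inE => /andP[yc exy].
have nxy : x != y by apply: contraTneq exy => <-; rewrite (proj2 Ge).
have adj u w : u \notin c -> e x u -> w \in c -> e x w -> ~~ e w u ->
    extendable e (size c).
  move=> uc exu wc exw; rewrite esym; exact: (extend_nonadjacent xc uc wc).
(* For neighbours of [x] two steps apart, [x] and [y] replace the vertex between them. *)
case: (pickP [pred u in A | next c (next c u) \in A]) => [u /= /andP[]|Ann].
  rewrite !inE !mem_next => /andP[uc exu] /andP[_ exb].
  have [eby|] := boolP (e (next c (next c u)) y); last first.
    by apply: adj => //; rewrite !mem_next.
  by apply: (extend_replace xc yc nxy uc) => //; rewrite esym.
have {}Ann u : u \in A -> next c (next c u) \notin A.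
  by move=> uA; move: (Ann u) => /=; rewrite uA /= => ->.
have A3 := card_disjoint_next2 Ac An Ann.
(* At most a third of the cycle is adjacent to [x], and the floor of [k/3] is below that of [k/2]
   once [k >= 4]. *)
have /card_gt1P[y1 [y2 []]] : 1 < #|B| by lia.
rewrite !inE => /andP[y1c exy1] /andP[y2c exy2] ny12.
have [ey1|] := boolP (e v y1); last exact: adj.
have [ey2|] := boolP (e v y2); last exact: adj.
apply: (extend_common_neighbor (x := x) (y := y1) (z := y2) _ xc y1c y2c vc) => //.
  rewrite /= !inE negb_or ny12 /= andbT.
  by apply/andP; split; [apply: contraTneq exy1|apply: contraTneq exy2] => <-;
    rewrite (proj2 Ge).
by rewrite esym.
Qed.

(** A third edge at [w] avoids both cycle edges there; [u] may lie on or off the cycle. *)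
Lemma chord_neighbor w :
  3 <= deg e w ->
  exists u, [/\ e w u, next c w != u & next c u != w].
Proof.
move=> dw; have U : uniq c by case/andP: Uc.
have : 0 < #|[set u | e w u] :\: [set next c w; prev c w]|.
  rewrite cardsD subn_gt0; apply: leq_ltn_trans dw.
  apply: leq_trans (subset_leq_card (subsetIr _ _)) _.
  by rewrite cards2; case: (_ != _).
case/card_gt0P=> u; rewrite !inE negb_or => /andP[/andP[un up] ewu].
exists u; split=> //; first by rewrite eq_sym.
by apply: contraNneq up => <-; rewrite prev_next.
Qed.

End Cycle.

(** * Reaching the cycle from [x] through the third edge at [w] *)

Lemma extend_chord e c x w :
  simple_graph e -> ucycle e c -> 3 < size c ->
  x \notin c -> (size c)./2 + 1 <= deg e x -> w \in c -> 3 <= deg e w ->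
  extendable e (size c).
Proof.
move=> Ge Uc c4 xc dx wc dw; have esym := proj1 Ge.
case: (pickP [pred v in c | e x v]) => [v /= /andP[vc exv]|xN].
  exact: (extend_adjacent Ge Uc c4 xc dx vc exv).
have {}xN v : v \in c -> ~~ e x v.
  by move=> vc; move: (xN v) => /=; rewrite vc /= => ->.
have [u [ewu nwu nuw]] := chord_neighbor Uc dw.
have nxu : x != u by apply: contraTneq ewu => <-; rewrite esym xN.
have nwu' : w != u by apply: contraTneq ewu => <-; rewrite (proj2 Ge).
have nxw : x != w by apply: contraNneq xc => ->.
have exN y : e x y -> x != y /\ y \notin c.
  move=> exy; split; first by apply: contraTneq exy => <-; rewrite (proj2 Ge).
  by apply: contraTN exy; apply: xN.
(* Such a [y] allows trading [xy], [wu] for [xw], [yu], which gives [x] a neighbour on the cycle. *)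
case: (pickP [pred y | [&& e x y, y != u & ~~ e y u]]) => [y /=|Nu].
  case/and3P=> exy nyu neyu; have [nxy yc] := exN _ exy.
  have nyw : y != w by apply: contraNneq yc => ->.
  have U4 : uniq [:: x; y; w; u].
    by rewrite /= !inE !negb_or nxy nxw nxu nyw nyu nwu'.
  have Gs : simple_graph (switch e x y w u) by apply: switch_simple.
  have ds := switch_deg Ge U4 exy ewu (xN _ wc) neyu.
  apply: (switch_extendable Ge U4 exy ewu (xN _ wc) neyu).
  apply: (extend_adjacent Gs _ c4 xc _ wc).
  - case/andP: Uc => Cc U; apply/andP; split=> //.
    (* The cycle survives: [x] and [y] lie off it, and [wu] is not one of its edges. *)
    apply: (cycle_from_next U) => v vc.
    have nvx : v != x by apply: contraNneq xc => <-.
    have nvy : v != y by apply: contraNneq yc => <-.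
    apply: switch_sub; first exact: next_cycle.
      by rewrite /edge (negPf nvx) (negPf nvy).
    rewrite /edge negb_or !negb_and.
    apply/andP; split; [have [->|//] := eqVneq v w|have [->|//] := eqVneq v u].
      by rewrite nwu orbT.
    by rewrite nuw orbT.
  - by rewrite ds.
  - by rewrite /switch /edge !eqxx !orbT.
have {}Nu y : e x y -> y != u -> e y u.
  by move=> exy nyu; move: (Nu y) => /=; rewrite exy nyu /= => /negbFE.
(* Since [k >= 4], [x] has at least three neighbours, so two remain besides [u]. *)
have /card_gt1P[y1 [y2 []]] : 1 < #|[set y | e x y] :\ u|.
  by move: dx; rewrite /deg (cardsD1 u); case: (_ \in _); lia.
rewrite !inE => /andP[ny1u exy1] /andP[ny2u exy2] ny12.
have [nxy1 y1c] := exN _ exy1; have [nxy2 y2c] := exN _ exy2.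
have ey1u := Nu _ exy1 ny1u; have ey2u := Nu _ exy2 ny2u.
have [uc|uc] := boolP (u \in c).
  apply: (extend_common_neighbor Ge Uc c4 (x := x) (y := y1) (z := y2) (v := u)) => //;
    rewrite 1?esym //.
  by rewrite /= !inE negb_or nxy1 nxy2 ny12.
(* The path is [w], [u], [y1]; the edge given up is [y1 x], as [x] has no neighbour on the cycle. *)
apply: (extend_path Ge Uc c4 (x := y1) (y := u) (z := x) _ y1c uc xc wc) => //;
  rewrite 1?esym //.
- by rewrite /= !inE negb_or ny1u (eq_sym y1) nxy1 eq_sym nxu.
- by rewrite esym xN // mem_next.
Qed.

End Extension.

Theorem theorem1 (k n : nat) (S : n.-tuple nat) (hk : 4 <= k)
  (hS : graphical S)
  (G : rel 'I_n) (hG : realization S G)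
  (C : seq 'I_n) (hC : cycle_of_length G k C)
  (x : 'I_n) (hxC : x \notin C) (hx : k./2 + 1 <= deg G x)
  (w : 'I_n) (hwC : w \in C) (hw : 3 <= deg G w) :
  exists (H : rel 'I_n) (D : seq 'I_n),
    realization S H /\ cycle_of_length H k.+1 D.
Proof.
case: hG hC => GG dG [_ sC UC]; subst k.
have [H [D [GH dH UD sD]]] := extend_chord GG UC hk hxC hx hwC hw.
exists H, D; split; first by split=> // i; rewrite dH.
by split=> //; apply: ltnW; apply: ltnW.
Qed.
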